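(* Let $n\geq 1$ and let $(\mathbb{R}^n,d_\infty)$ be the usual $n$-dimensional space equipped with the max-distance. Let $$M^n_+:=\{(x_k)_{1\le k\le n}\in\mathbb{R}^n:\ x_k\ge 0 \text{ for all } k,\ |x_i-x_j|\le 1 \text{ for all } 1\le i,j\le n\},$$ $$M^n:=\{(x_k)_{1\le k\le n}\in\mathbb{R}^n:\ |x_i-x_j|\le 1 \text{ for all } 1\le i,j\le n\}.$$ Let $G=\{g_1,\dots,g_n\}$ be a group of cardinality $n$, where $g_1$ is the identity of $G$. Define the law $\star_G$ on $\mathbb{R}^n$ by: for $x=(x_k)_k,\ y=(y_k)_k\in\mathbb{R}^n$, $x\star_G y=(z_k)_{1\le k\le n}$, where for each $1\le k\le n$, $$z_k:=\min\{x_i+y_j:\ g_i\cdot g_j=g_k,\ 1\le i,j\le n\}.$$ Then: (1) $(\mathbb{R}^n,\star_G)$ is a semigroup (and is abelian if $G$ is abelian). (2) $(M^n_+,\star_G)$ and $(M^n,\star_G)$ are monoids having $e=(0,1,1,\dots,1)$ as identity element. (3) Let $G$ and $G'$ be two groups of cardinality $n$. The monoids $(M^n_+,\star_G)$ and $(M^n_+,\star_{G'})$ are isomorphic if and only if the groups $G$ and $G'$ are isomorphic. (4) $\mathcal{U}(M^n_+)\simeq G$ and $\mathcal{U}(M^n)\simeq G\times\mathbb{R}$. Moreover, the maximal subgroup of $(\mathbb{R}^n,\star_G)$ having $e$ as identity element is isomorphic to the group $G\times\mathbb{R}$. (5) $Is_m(M^n_+)\simeq Aut(G)$.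
   Context: For a monoid $(M,\cdot)$ with identity $e_M$, $\mathcal{U}(M)=\{m\in M:\ \exists m'\in M,\ m\cdot m'=m'\cdot m=e_M\}$ is its group of units. The symbol $\simeq$ means isomorphic as groups. $\mathbb{R}$ is regarded as an additive group. For a monoid $A$ equipped with a metric, $Is_m(A)$ is the group (under composition) of all isometric automorphisms of the monoid $A$, i.e. bijective monoid homomorphisms $A\to A$ preserving the metric; here $M^n_+$ carries the operation $\star_G$ and the metric $d_\infty$. $Aut(G)$ is the group of automorphisms of $G$. The maximal subgroup of a semigroup $S$ having $e$ as identity element is the largest subset of $S$ containing $e$ that is a group under the operation of $S$ with identity $e$. *)

(* Defs.v *)
From HB Require Import structures.
From mathcomp Require Import all_boot all_order all_algebra all_fingroup.
From mathcomp Require Import all_classical all_reals all_analysis.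
Set Implicit Arguments.
Unset Strict Implicit.
Unset Printing Implicit Defensive.
Import Order.TTheory GRing.Theory Num.Theory.
Import numFieldNormedType.Exports.
Local Open Scope classical_set_scope.
Local Open Scope ring_scope.

(* Algebraic structures are carried by a set A together with an operation on
   the ambient type T; only the values of the operation on A matter. *)
Section Structures.
Context {T : Type}.
Implicit Types (A H : set T) (op : T -> T -> T) (e : T).

Definition is_semigroup A op : Prop :=
  (forall x y, A x -> A y -> A (op x y)) /\
  (forall x y z, A x -> A y -> A z -> op x (op y z) = op (op x y) z).

Definition is_abelian A op : Prop :=
  forall x y, A x -> A y -> op x y = op y x.

Definition is_monoid A op e : Prop :=
  [/\ is_semigroup A op, A e &
      forall x, A x -> op e x = x /\ op x e = x].

Definition is_group A op e : Prop :=
  is_monoid A op e /\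
  forall x, A x -> exists2 y, A y & op x y = e /\ op y x = e.

Definition units A op e : set T :=
  [set x | A x /\ exists2 y, A y & op x y = e /\ op y x = e].

Definition is_maximal_subgroup A op e H : Prop :=
  [/\ H `<=` A, is_group H op e &
      forall K : set T, K `<=` A -> is_group K op e -> K `<=` H].

End Structures.

Section Isomorphisms.
Context {T U : Type}.
Implicit Types (A : set T) (B : set U).

Definition monoid_isomorphic A opA eA B opB eB : Prop :=
  exists f : T -> U,
    [/\ set_bij A B f,
        forall x y, A x -> A y -> f (opA x y) = opB (f x) (f y) &
        f eA = eB].

Definition group_isomorphic A opA eA B opB eB : Prop :=
  [/\ is_group A opA eA, is_group B opB eB &
      exists2 f : T -> U, set_bij A B f &
        forall x y, A x -> A y -> f (opA x y) = opB (f x) (f y)].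

End Isomorphisms.

(* The maps live on the subtype of elements of A, so that they form a group
   under composition.  As op is defined on the ambient type, "f (x op y) is
   f x op f y" is expressed on the graph of op. *)
Definition isometric_automorphisms {R : realType} {T : Type} (d : T -> T -> R)
    (A : set T) (op : T -> T -> T) (e : T) : set (A -> A) :=
  [set f : A -> A |
    [/\ bijective f,
        forall x y z : A, val z = op (val x) (val y) ->
          val (f z) = op (val (f x)) (val (f y)),
        forall x : A, val x = e -> val (f x) = e &
        forall x y : A, d (val (f x)) (val (f y)) = d (val x) (val y)]].

Arguments isometric_automorphisms {R T} d A op e.

Definition prodR_mul {R : realType} {G : finGroupType} (p q : G * R) : G * R :=
  ((p.1 * q.1)%g, p.2 + q.2).

Definition prodR_one {R : realType} {G : finGroupType} : G * R := (1%g, 0).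

Section Spaces.
Context {R : realType} {n : nat}.

(* The norm on matrices is the maximum of the absolute values of the entries. *)
Definition dinfty (x y : 'rV[R]_n) : R := `|x - y|.

Definition Mspace : set 'rV[R]_n :=
  [set x | forall i j, `|x ord0 i - x ord0 j| <= 1].

Definition Mplus : set 'rV[R]_n :=
  [set x | (forall k, 0 <= x ord0 k) /\
           (forall i j, `|x ord0 i - x ord0 j| <= 1)].

End Spaces.
Arguments Mspace : clear implicits.
Arguments Mplus : clear implicits.

Section Star.
Context {R : realType} {n : nat}.

Definition evec : 'rV[R]_n.+1 := \row_k (if k == ord0 then 0 else 1).

(* The minimum of x_i + y_j over g_i g_j = g_k.  The iterated minimum is
   started at x_1 + y_k, which is one of the terms because g_1 = 1. *)
Definition star {G : finGroupType} (g : 'I_n.+1 -> G) (x y : 'rV[R]_n.+1) :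
    'rV[R]_n.+1 :=
  \row_k \big[Num.min/x ord0 ord0 + y ord0 k]_(p : 'I_n.+1 * 'I_n.+1 |
            (g p.1 * g p.2)%g == g k) (x ord0 p.1 + y ord0 p.2).

End Star.

Definition group_enumeration {n : nat} {G : finGroupType}
    (g : 'I_n.+1 -> G) : Prop :=
  bijective g /\ g ord0 = 1%g.

(* Main.v *)
(* Read on G, [star] is the min-plus convolution and the identity e is the
   indicator of G minus the identity.  For x, y in M^n with x y = y x = e, the
   value 0 of e at 1 is some x_a + y_(a^-1), and the bound 1 on oscillations
   then forces y to be a translate of e by a^-1 and a constant: the units are
   G x R, and only the constant 0 survives in M^n_+.  An isometric automorphism
   of M^n_+ permutes the units through an automorphism of G; a point with large
   coordinates is determined by its distances to the units, and all other
   points are reached from those by cancelling a central translation. *)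
Require Import Defs.
From HB Require Import structures.
From mathcomp Require Import all_boot all_order all_algebra all_fingroup.
From mathcomp Require Import all_classical all_reals all_analysis.
From mathcomp Require Import lra.
Import Order.TTheory GRing.Theory Num.Theory.
Import numFieldNormedType.Exports.
Local Open Scope classical_set_scope.
Local Open Scope ring_scope.

Set Implicit Arguments.
Unset Strict Implicit.

(** * Transport of a group structure along an injection, and the model groups *)

Lemma group_isomorphic_image {T : Type} {U : choiceType} (B : set U)
    (opB : U -> U -> U) (eB : U) (opA : T -> T -> T) (eA : T) (h : U -> T) :
  is_group B opB eB -> set_inj B h ->
  (forall u v, B u -> B v -> h (opB u v) = opA (h u) (h v)) -> h eB = eA ->
  group_isomorphic (h @` B) opA eA B opB eB.
Proof.
move=> grpB hI hM h1.
have [[[[BM BA] B1 Be] BV]] := (grpB, I).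
(* The isomorphism must go from the image back to [B], so [h] is inverted by choice; the default
   [eB] is taken only off the image. *)
pose k (t : T) := xget eB [set u | B u /\ h u = t].
have hK u : B u -> k (h u) = u.
  move=> Bu; apply: xget_unique => // v [Bv hvu].
  by apply: hI; rewrite ?inE.
split=> //.
- split; first split; first split.
  + move=> _ _ [u Bu <-] [v Bv <-]; exists (opB u v); first exact: BM.
    exact: hM.
  + move=> _ _ _ [u Bu <-] [v Bv <-] [w Bw <-].
    by rewrite -!hM ?BA//; apply: BM.
  + by exists eB.
  + move=> _ [u Bu <-]; have [eu ue] := Be u Bu.
    by rewrite -h1 -!hM ?eu ?ue.
  + move=> _ [u Bu <-]; have [v Bv [uv vu]] := BV u Bu.
    by exists (h v); [exists v | rewrite -!hM// uv vu].
- exists k; first split.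
  + by move=> _ [u Bu <-]; rewrite /= hK.
  + move=> x y /set_mem[u Bu <-] /set_mem[v Bv <-].
    by rewrite !hK// => ->.
  + by move=> u Bu; exists (h u); [exists u | rewrite hK].
  + move=> _ _ [u Bu <-] [v Bv <-].
    by rewrite -hM// !hK//; apply: BM.
Qed.

Lemma is_group_finGroup (G : finGroupType) :
  is_group [set: G] (fun a b : G => (a * b)%g) 1%g.
Proof.
split=> [|a _].
  split=> [|//|a _]; last by rewrite mul1g mulg1.
  by split=> [//|a b c _ _ _]; rewrite mulgA.
by exists a^-1%g => //; rewrite mulgV mulVg.
Qed.

Lemma is_group_prodR (R : realType) (G : finGroupType) :
  is_group [set: G * R] prodR_mul prodR_one.
Proof.
split=> [|[a r] _].
  split=> [|//|[a r] _]; last by rewrite /prodR_mul/= mul1g mulg1 add0r addr0.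
  by split=> [//|a b c _ _ _]; rewrite /prodR_mul/= mulgA addrA.
exists (a^-1%g, - r) => //.
by rewrite /prodR_mul/= mulgV mulVg subrr addNr.
Qed.

Lemma is_group_subgroup (gT : finGroupType) (H : {group gT}) :
  is_group [set` H] (fun a b : gT => (a * b)%g) 1%g.
Proof.
split=> [|a Ha].
  split=> [|/=|a _]; [|exact: group1|by rewrite mul1g mulg1].
  split=> [a b Ha Hb|a b c _ _ _]; last by rewrite mulgA.
  exact: groupM.
by exists a^-1%g; [rewrite /= groupV | rewrite mulgV mulVg].
Qed.

(* [ig] is meant to be the inverse of the enumeration [g] of G. *)
Definition ev {R : realType} {n : nat} {G : finGroupType} (ig : G -> 'I_n.+1)
  (x : 'rV[R]_n.+1) (a : G) : R := x ord0 (ig a).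

(* The translate of [evec] by the group element p.1 and the real number p.2. *)
Definition delta {R : realType} {n : nat} {G : finGroupType}
    (g : 'I_n.+1 -> G) (p : G * R) : 'rV[R]_n.+1 :=
  \row_k (p.2 + (g k != p.1)%:R).

Definition pull {R : realType} {n : nat} {G G' : finGroupType}
    (ig : G -> 'I_n.+1) (g' : 'I_n.+1 -> G') (f : G' -> G)
    (x : 'rV[R]_n.+1) : 'rV[R]_n.+1 :=
  \row_k ev ig x (f (g' k)).

(** * Min-plus convolution of functions on G *)

Section Convolution.
Context {R : realType} {n : nat} {G : finGroupType}.
Context {g : 'I_n.+1 -> G} {ig : G -> 'I_n.+1}.
Hypotheses (gK : cancel g ig) (igK : cancel ig g) (g0 : g ord0 = 1%g).
Implicit Types (x y z : 'rV[R]_n.+1) (a b c : G) (p q : G * R).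
Local Notation "x '[*]' y" := (star g x y) (at level 40).
Local Notation ev := (ev ig).
Local Notation delta := (delta g).

Lemma evE x k : x ord0 k = ev x (g k).
Proof. by rewrite /ev gK. Qed.

Lemma ev_inj x y : ev x =1 ev y -> x = y.
Proof. by move=> xy; apply/rowP => k; rewrite !evE xy. Qed.

Lemma ev_star_le x y a b : ev (x [*] y) (a * b)%g <= ev x a + ev y b.
Proof.
rewrite /ev mxE; apply: (bigmin_le_cond _ (j := (ig a, ig b))) => /=.
by rewrite !igK.
Qed.

Lemma ev_star_ge x y c m :
  (forall a b, (a * b = c)%g -> m <= ev x a + ev y b) -> m <= ev (x [*] y) c.
Proof.
move=> mP; rewrite /ev mxE; apply/bigmin_geP; split=> [|[i j] /= /eqP gij].
  (* The starting value of the minimum is the term of the factorization 1 c = c. *)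
  by rewrite (evE x) (evE y); apply: mP; rewrite g0 mul1g igK.
by rewrite (evE x) (evE y); apply: mP; rewrite gij igK.
Qed.

Lemma ev_star_attained x y c :
  exists a b, (a * b = c)%g /\ ev (x [*] y) c = ev x a + ev y b.
Proof.
(* The minimum is at most itself, so [bigmin_leP] yields a term below it: the starting value or an
   indexed one. *)
have: ev (x [*] y) c <= ev (x [*] y) c by [].
rewrite {1}/ev mxE => /bigmin_leP[le0|[[i j] /= /eqP gij leij]].
  exists 1%g, c; split; first exact: mul1g.
  apply/le_anti; rewrite -{1}[c]mul1g ev_star_le/=.
  by move: le0; rewrite evE g0.
exists (g i), (g j); rewrite gij igK; split=> //.
apply/le_anti; move: leij; rewrite !evE => ->; rewrite andbT.
by rewrite -{1}[c]igK -gij ev_star_le.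
Qed.

(** Both sides at c are the minimum of x_a + y_b + z_d over a b d = c: terms attaining one side are
    regrouped to bound the other. *)
Lemma starA x y z : x [*] (y [*] z) = (x [*] y) [*] z.
Proof.
apply: ev_inj => c; apply/le_anti/andP; split.
  have [ab [d [<- ->]]] := ev_star_attained (x [*] y) z c.
  have [a [b [<- ->]]] := ev_star_attained x y ab.
  rewrite -mulgA -addrA; apply: le_trans (ev_star_le _ _ _ _) _.
  by rewrite lerD2l ev_star_le.
have [a [bd [<- ->]]] := ev_star_attained x (y [*] z) c.
have [b [d [<- ->]]] := ev_star_attained y z bd.
rewrite mulgA addrA; apply: le_trans (ev_star_le _ _ _ _) _.
by rewrite lerD2r ev_star_le.
Qed.

Lemma star_semigroup : is_semigroup [set: 'rV[R]_n.+1] (star g).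
Proof. by split=> [//|x y z _ _ _]; exact: starA. Qed.

Lemma star_abelian :
  abelian [set: G]%SET -> is_abelian [set: 'rV[R]_n.+1] (star g).
Proof.
move=> /centsP cG.
have le_star x y c : ev (x [*] y) c <= ev (y [*] x) c.
  have [a [b [<- ->]]] := ev_star_attained y x c.
  by rewrite (cG a) ?inE// addrC ev_star_le.
by move=> x y _ _; apply: ev_inj => c; apply/le_anti; rewrite !le_star.
Qed.

(** * Stability of M^n and M^n_+, and the action of the translates of e *)

Lemma MspaceP x : Mspace R n.+1 x <-> forall a b, ev x a <= ev x b + 1.
Proof.
split=> [Mx a b|xP i j].
  by have := Mx (ig a) (ig b); rewrite ler_norml /ev; lra.
by have := (xP (g i) (g j), xP (g j) (g i)); rewrite ler_norml -!evE => -[]; lra.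
Qed.

Lemma MplusP x : Mplus R n.+1 x <-> (forall a, 0 <= ev x a) /\ Mspace R n.+1 x.
Proof.
split=> -[x0 Mx]; split=> // k; first exact: x0.
by rewrite evE.
Qed.

Lemma Mplus_Mspace x : Mplus R n.+1 x -> Mspace R n.+1 x.
Proof. by case. Qed.

(** If (a, b) attains the value at d, then (a, a^-1 c) competes at c, and only its y-term differs,
    by at most 1. *)
Lemma Mspace_star x y :
  Mspace R n.+1 x -> Mspace R n.+1 y -> Mspace R n.+1 (x [*] y).
Proof.
move=> _ /MspaceP My; apply/MspaceP => c d.
have [a [b [<- ->]]] := ev_star_attained x y d.
have := My (a^-1 * c)%g b.
have := ev_star_le x y a (a^-1 * c)%g; rewrite mulKVg; lra.
Qed.

Lemma Mplus_star x y :
  Mplus R n.+1 x -> Mplus R n.+1 y -> Mplus R n.+1 (x [*] y).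
Proof.
move=> /MplusP[x0 Mx] /MplusP[y0 My].
apply/MplusP; split; last exact: Mspace_star.
by move=> c; apply: ev_star_ge => a b _; rewrite addr_ge0.
Qed.

Lemma ev_delta p c : ev (delta p) c = p.2 + (c != p.1)%:R.
Proof. by rewrite /ev mxE igK. Qed.

Lemma Mspace_delta p : Mspace R n.+1 (delta p).
Proof.
apply/MspaceP => a b; rewrite !ev_delta.
by case: (a == _); case: (b == _) => /=; lra.
Qed.

Lemma Mplus_delta p : 0 <= p.2 -> Mplus R n.+1 (delta p).
Proof.
move=> p0; apply/MplusP; split; last exact: Mspace_delta.
by move=> a; rewrite ev_delta addr_ge0.
Qed.

Lemma evec_delta : evec = delta (1%g, 0) :> 'rV[R]_n.+1.
Proof.
apply/rowP => k; rewrite !mxE add0r -g0 (can_eq gK).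
by case: (k == ord0).
Qed.

Lemma ev_star_deltal p x c :
  Mspace R n.+1 x -> ev (delta p [*] x) c = p.2 + ev x (p.1^-1 * c)%g.
Proof.
move=> /MspaceP Mx; apply/le_anti/andP; split.
  have := ev_star_le (delta p) x p.1 (p.1^-1 * c)%g.
  by rewrite mulKVg ev_delta eqxx addr0.
apply: ev_star_ge => a b <-; rewrite ev_delta.
have [->|_] := eqVneq a p.1; first by rewrite mulKg addr0.
have := Mx (p.1^-1 * (a * b))%g b; rewrite /=; lra.
Qed.

Lemma ev_star_deltar p x c :
  Mspace R n.+1 x -> ev (x [*] delta p) c = ev x (c * p.1^-1)%g + p.2.
Proof.
move=> /MspaceP Mx; apply/le_anti/andP; split.
  have := ev_star_le x (delta p) (c * p.1^-1)%g p.1.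
  by rewrite mulgKV ev_delta eqxx addr0.
apply: ev_star_ge => a b <-; rewrite ev_delta.
have [->|_] := eqVneq b p.1; first by rewrite mulgK addr0.
have := Mx (a * b * p.1^-1)%g a; rewrite /=; lra.
Qed.

Lemma star_delta p q : delta p [*] delta q = delta (prodR_mul p q).
Proof.
apply: ev_inj => c; rewrite ev_star_deltal ?ev_delta; last exact: Mspace_delta.
by rewrite addrA (can2_eq (mulKVg _) (mulKg _)).
Qed.

Lemma delta_inj : injective (delta : G * R -> 'rV[R]_n.+1).
Proof.
move=> [a r] [b s] eq_ab; have evab c : ev (delta (a, r)) c = ev (delta (b, s)) c.
  by rewrite eq_ab.
(* Comparison at a and at b: if a and b differ, then r = s + 1 and r + 1 = s. *)
have := (evab a, evab b); rewrite !ev_delta/= !eqxx (eq_sym b a).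
by move=> {eq_ab evab}; case: eqVneq => /= [->|_] [ab0 ab1];
  [have -> : r = s by lra | exfalso; lra].
Qed.

Lemma star1x x : Mspace R n.+1 x -> evec [*] x = x.
Proof.
move=> Mx; apply: ev_inj => c.
by rewrite evec_delta ev_star_deltal//= add0r invg1 mul1g.
Qed.

Lemma starx1 x : Mspace R n.+1 x -> x [*] evec = x.
Proof.
move=> Mx; apply: ev_inj => c.
by rewrite evec_delta ev_star_deltar//= addr0 invg1 mulg1.
Qed.

Lemma Mplus_monoid : is_monoid (Mplus R n.+1) (star g) evec.
Proof.
split; [split; [exact: Mplus_star | by move=> *; exact: starA] | |].
  by rewrite evec_delta; exact: Mplus_delta.
by move=> x /Mplus_Mspace Mx; rewrite star1x ?starx1.
Qed.

Lemma Mspace_monoid : is_monoid (Mspace R n.+1) (star g) evec.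
Proof.
split; [split; [exact: Mspace_star | by move=> *; exact: starA] | |].
  by rewrite evec_delta; exact: Mspace_delta.
by move=> x Mx; rewrite star1x ?starx1.
Qed.

(** * Units of the two monoids and the maximal subgroup at e *)

Lemma Mspace_fixed x : evec [*] x = x -> Mspace R n.+1 x.
Proof.
move=> ex; apply/MspaceP => a b.
(* Since e is at most 1 everywhere, x_a <= e_(a b^-1) + x_b <= 1 + x_b. *)
have := ev_star_le evec x (a * b^-1)%g b.
by rewrite mulgKV ex evec_delta ev_delta/= => {ex}; case: (_ == _) => /=; lra.
Qed.

(* If x_a + y_(a^-1) realizes the value 0 of e at 1, then the values 1 of e
   elsewhere and the bound on the oscillation of y leave no freedom for y. *)
Lemma star_eq_evec x y : Mspace R n.+1 y -> x [*] y = evec ->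
  exists2 p, y = delta p & p.2 = - ev x p.1^-1%g.
Proof.
move=> /MspaceP My xy.
have [a [b [ab /esym]]] := ev_star_attained x y 1%g.
rewrite xy evec_delta ev_delta eqxx addr0 => /= xayb.
have aE : a = b^-1%g by rewrite -(mulgK b a) ab mul1g.
exists (b, - ev x a); last by rewrite /= aE.
apply: ev_inj => c; rewrite ev_delta/=.
have [->|cb] := eqVneq c b; first by move=> {xy} /=; lra.
have := ev_star_le x y a c; rewrite xy evec_delta ev_delta/=.
rewrite {xy} (_ : (a * c == 1)%g = false) => [|]; last first.
  by apply: contra_neqF cb; rewrite -ab => /eqP/mulgI.
by have := My c b; rewrite /=; lra.
Qed.

Lemma units_Mspace : units (Mspace R n.+1) (star g) evec = delta @` [set: G * R].
Proof.
apply/seteqP; split=> x.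
  by move=> [Mx [y My [_ /(star_eq_evec Mx)[p -> _]]]]; exists p.
move=> [[a r] _ <-]; split; first exact: Mspace_delta.
exists (delta (a^-1%g, - r)); first exact: Mspace_delta.
by rewrite !star_delta /prodR_mul/= mulgV mulVg subrr addNr evec_delta.
Qed.

Lemma units_Mplus :
  units (Mplus R n.+1) (star g) evec = (fun a => delta (a, 0)) @` [set: G].
Proof.
apply/seteqP; split=> x.
  move=> [Mx [y /MplusP[y0 My] [_ yx]]].
  have [[a r] xE /= rE] := star_eq_evec (Mplus_Mspace Mx) yx.
  exists a => //; rewrite xE; congr (delta (_, _)).
  (* Here r = x_a >= 0, while r = - y_(a^-1) <= 0. *)
  have /MplusP[/(_ a)] := Mx; rewrite xE ev_delta eqxx/= => {xE yx}.
  by have := y0 a^-1%g; lra.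
move=> [a _ <-]; split; first exact: Mplus_delta.
exists (delta (a^-1%g, 0)); first exact: Mplus_delta.
by rewrite !star_delta /prodR_mul/= mulgV mulVg addr0 evec_delta.
Qed.

Lemma units_Mplus_isomorphic :
  group_isomorphic (units (Mplus R n.+1) (star g) evec) (star g) evec
    [set: G] (fun a b : G => (a * b)%g) 1%g.
Proof.
rewrite units_Mplus; apply: group_isomorphic_image.
- exact: is_group_finGroup.
- by move=> a b _ _ /delta_inj[].
- by move=> a b _ _; rewrite star_delta /prodR_mul addr0.
- by rewrite evec_delta.
Qed.

Lemma units_Mspace_isomorphic :
  group_isomorphic (units (Mspace R n.+1) (star g) evec) (star g) evec
    [set: G * R] prodR_mul prodR_one.
Proof.
rewrite units_Mspace; apply: group_isomorphic_image.
- exact: is_group_prodR.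
- by move=> p q _ _ /delta_inj.
- by move=> p q _ _; rewrite star_delta.
- by rewrite evec_delta.
Qed.

(** In a subgroup K with identity e, every element is fixed by e, hence lies in M^n by
    [Mspace_fixed]; its inverse in K does too, so it is a unit of M^n. *)
Lemma units_Mspace_maximal :
  is_maximal_subgroup [set: 'rV[R]_n.+1] (star g) evec
    (units (Mspace R n.+1) (star g) evec).
Proof.
split=> //; first by case: units_Mspace_isomorphic.
move=> K _ [[_ _ Ke] KV].
have KM x : K x -> Mspace R n.+1 x by move=> /Ke[/Mspace_fixed].
move=> x Kx; have [y Ky xy] := KV x Kx.
by split; [exact: KM | exists y; first exact: KM].
Qed.

(** * Distances to the units of M^n_+ *)

Lemma dinfty_leP x y r :
  dinfty x y <= r <-> forall a, `|ev x a - ev y a| <= r.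
Proof.
rewrite /dinfty [`|x - y|]mx_normrE; split=> [/bigmax_leP[_ xyr] a|xyr].
  by have := xyr (ord0, ig a) isT; rewrite !mxE.
(* The maximum starts at 0, and 0 <= r is read off the coordinate at 1. *)
apply/bigmax_leP; split=> [|[i j] _ /=]; first exact: le_trans (xyr 1%g).
by rewrite !mxE (ord1 i) !evE.
Qed.

(** Coordinate a contributes x_a. Any other b contributes x_b - 1, which is nonnegative and at most
    x_a by the oscillation bound. *)
Lemma dinfty_delta x a : Mspace R n.+1 x -> (forall b, 2 <= ev x b) ->
  dinfty x (delta (a, 0)) = ev x a.
Proof.
move=> /MspaceP Mx x2; apply/le_anti/andP; split.
  apply/dinfty_leP => b; rewrite ev_delta ler_norml/=.
  have := (x2 a, x2 b, Mx b a) => -[[]].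
  by case: eqVneq => [->|_] /=; lra.
have /dinfty_leP/(_ a) : dinfty x (delta (a, 0)) <= dinfty x (delta (a, 0)) by [].
by rewrite ev_delta eqxx ler_norml/=; lra.
Qed.

(** Recovers a coordinate from a distance. The hypothesis bears on the distance because that is what
    an isometry preserves: the lemma is applied to an image point whose coordinates are still
    unknown. Coordinates other than a contribute at most max(x_a, 1), so a distance of at least 2
    can only be x_a. *)
Lemma ev_dinfty_delta x a : Mplus R n.+1 x -> 2 <= dinfty x (delta (a, 0)) ->
  ev x a = dinfty x (delta (a, 0)).
Proof.
move=> /MplusP[x0 /MspaceP Mx] d2; apply/le_anti/andP; split.
  have /dinfty_leP/(_ a) : dinfty x (delta (a, 0)) <= dinfty x (delta (a, 0)) by [].
  by rewrite ev_delta eqxx ler_norml/=; lra.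
have : dinfty x (delta (a, 0)) <= Num.max (ev x a) 1.
  apply/dinfty_leP => b; rewrite ev_delta ler_norml/=.
  have := (x0 a, x0 b, Mx b a) => -[[]].
  by rewrite maxEle; case: ifP; case: eqVneq => [->|_] /=; lra.
by rewrite maxEle; case: ifP => //; lra.
Qed.

End Convolution.

(** * Relabelling coordinates along a map of groups *)

Section Pull.
Context {R : realType} {n : nat} {G G' : finGroupType}.
Context {g : 'I_n.+1 -> G} {ig : G -> 'I_n.+1}.
Context {g' : 'I_n.+1 -> G'} {ig' : G' -> 'I_n.+1}.
Hypotheses (gK : cancel g ig) (igK : cancel ig g) (g0 : g ord0 = 1%g).
Hypotheses (gK' : cancel g' ig') (igK' : cancel ig' g') (g0' : g' ord0 = 1%g).
Implicit Types (x y : 'rV[R]_n.+1) (f : G' -> G).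

Lemma ev_pull f x c : ev ig' (pull ig g' f x) c = ev ig x (f c).
Proof. by rewrite {1}/ev mxE igK'. Qed.

Lemma pull_Mplus f x : Mplus R n.+1 x -> Mplus R n.+1 (pull ig g' f x).
Proof.
move=> /(MplusP gK)[x0 /(MspaceP gK) Mx].
apply/(MplusP gK'); split; first by move=> a; rewrite ev_pull.
by apply/(MspaceP gK') => a b; rewrite !ev_pull.
Qed.

Lemma pull_delta f h a (r : R) : cancel f h -> cancel h f ->
  pull ig g' f (delta g (a, r)) = delta g' (h a, r).
Proof.
move=> fK hK; apply: (ev_inj gK') => c.
by rewrite ev_pull ev_delta// ev_delta//= (can2_eq fK hK).
Qed.

Lemma pull_star f h x y : cancel f h -> cancel h f ->
    {morph f : a b / (a * b)%g >-> (a * b)%g} ->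
  pull ig g' f (star g x y) = star g' (pull ig g' f x) (pull ig g' f y).
Proof.
move=> fK hK fM; apply: (ev_inj gK') => c; rewrite ev_pull.
apply/le_anti/andP; split.
  apply: (ev_star_ge gK' igK' g0') => a b <-.
  by rewrite !ev_pull fM ev_star_le.
(* Through h, an optimal factorization of f c in G becomes one of c in G'. *)
have [a [b [ab ->]]] := ev_star_attained gK igK g0 x y (f c).
rewrite -[in leRHS](hK a) -[in leRHS](hK b) -!ev_pull.
have -> : c = (h a * h b)%g by apply: (can_inj fK); rewrite fM !hK.
exact: ev_star_le.
Qed.

Lemma pull_dinfty f h x y : cancel h f ->
  dinfty (pull ig g' f x) (pull ig g' f y) = dinfty x y.
Proof.
move=> hK; apply/le_anti/andP; split.
  apply/(dinfty_leP gK') => a; rewrite !ev_pull.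
  exact: (dinfty_leP gK x y _).1.
apply/(dinfty_leP gK) => a; rewrite -[a]hK -!ev_pull.
exact: (dinfty_leP gK' _ _ _).1.
Qed.

End Pull.

Lemma pull_comp {R : realType} {n : nat} {G1 G2 G3 : finGroupType}
    (ig1 : G1 -> 'I_n.+1) (g2 : 'I_n.+1 -> G2) (ig2 : G2 -> 'I_n.+1)
    (g3 : 'I_n.+1 -> G3) (f : G2 -> G1) (h : G3 -> G2) (x : 'rV[R]_n.+1) :
  cancel ig2 g2 ->
  pull ig2 g3 h (pull ig1 g2 f x) = pull ig1 g3 (f \o h) x.
Proof. by move=> igK2; apply/rowP => k; rewrite !mxE /ev mxE igK2. Qed.

Lemma pull_id {R : realType} {n : nat} {G : finGroupType} (g : 'I_n.+1 -> G)
    (ig : G -> 'I_n.+1) (f : G -> G) (x : 'rV[R]_n.+1) :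
  cancel g ig -> f =1 id -> pull ig g f x = x.
Proof. by move=> gK fE; apply/rowP => k; rewrite mxE fE -evE. Qed.

(** * Isomorphisms between the monoids of two groups *)

Lemma isog_setTP (G G' : finGroupType) :
  [set: G]%SET \isog [set: G']%SET <->
  exists f : G -> G', bijective f /\ {morph f : a b / (a * b)%g >-> (a * b)%g}.
Proof.
split=> [isoG|[f [[h fK hK] fM]]].
  have [f injf imf] := isogP isoG; exists f; split; last first.
    by move=> a b; rewrite morphM ?inE.
  apply: inj_card_bij; first by move=> a b; apply: (injmP injf); rewrite ?inE.
  by rewrite -[#|G'|]cardsT -[#|G|]cardsT (card_isog isoG).
pose F := @Morphism _ _ [set: G]%SET f (fun a b _ _ => fM a b).
apply/isogP; exists F; first by apply/injmP => a b _ _ /(can_inj fK).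
apply/setP => b; rewrite inE; apply/morphimP.
by exists (h b); rewrite ?inE//= hK.
Qed.

(** A group isomorphism relabels the coordinates; conversely, a monoid isomorphism restricts to the
    units, which form a copy of the group. *)
Lemma Mplus_isomorphic_isog (R : realType) (n : nat) (G G' : finGroupType)
    (g : 'I_n.+1 -> G) (g' : 'I_n.+1 -> G') :
  group_enumeration g -> group_enumeration g' ->
  monoid_isomorphic (Mplus R n.+1) (star g) evec
                    (Mplus R n.+1) (star g') evec <->
  [set: G]%SET \isog [set: G']%SET.
Proof.
move=> [[ig gK igK] g0] [[ig' gK' igK'] g0']; split; last first.
  (* [pull] is contravariant, so the isomorphism is taken from G' to G. *)
  rewrite isog_sym => /isog_setTP[f [[h fK hK] fM]].
  exists (pull ig g' f); split.
  - split.
    + by move=> x; apply: pull_Mplus.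
    + move=> x y _ _ /(congr1 (pull ig' g h)).
      by rewrite !pull_comp// !pull_id.
    + move=> y My; exists (pull ig' g h y); first exact: pull_Mplus My.
      by rewrite pull_comp// pull_id.
  - by move=> x y _ _; apply: pull_star.
  - rewrite [RHS](evec_delta gK' g0') (evec_delta gK g0) (pull_delta igK gK' igK' _ _ fK hK).
    suff -> : h 1%g = 1%g by [].
    by apply: (can_inj fK); apply: (mulgI (f 1%g)); rewrite hK mulg1 -fM mulg1.
move=> [F [[FM Finj _] Fstar Fe]].
have Md (a : G) : Mplus R n.+1 (delta g (a, 0)) by exact: Mplus_delta.
have F_unit (a : G) : exists b : G', F (delta g (a, 0)) = delta g' (b, 0).
  suff : units (Mplus R n.+1) (star g') evec (F (delta g (a, 0))).
    by rewrite (units_Mplus gK' igK' g0') => -[b _ <-]; exists b.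
  split; first exact: FM.
  exists (F (delta g (a^-1%g, 0))); first exact: FM.
  rewrite -!Fstar// !(star_delta gK igK g0) /prodR_mul/= mulgV mulVg addr0.
  by rewrite -(evec_delta gK g0).
have [f fE] := choice F_unit.
apply/isog_setTP; exists f; split.
  (* Injectivity suffices, as both groups are enumerated by ['I_n.+1]. *)
  apply: inj_card_bij; last first.
    by rewrite -(bij_eq_card (Bijective gK igK)) -(bij_eq_card (Bijective gK' igK')).
  move=> a b fab; have : delta (R := R) g (a, 0) = delta g (b, 0).
    by apply: Finj; rewrite ?inE// !fE fab.
  by move=> /(delta_inj igK)[].
move=> a b; have := Fstar _ _ (Md a) (Md b).
rewrite (star_delta gK igK g0) !fE (star_delta gK' igK' g0') /prodR_mul/=.
by rewrite addr0 fE => /(delta_inj igK')[].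
Qed.

(** * Isometric automorphisms of M^n_+ *)

Section Automorphisms.
Context {R : realType} {n : nat} {G : finGroupType}.
Context {g : 'I_n.+1 -> G} {ig : G -> 'I_n.+1}.
Hypotheses (gK : cancel g ig) (igK : cancel ig g) (g0 : g ord0 = 1%g).
Local Notation A := (Mplus R n.+1).
Implicit Types (x y : A) (s t : {perm G}) (a b c : G).

Lemma Mplus_val x : A (val x).
Proof. exact: set_mem (valP x). Qed.

Definition Mplus_sub (v : 'rV[R]_n.+1) (Av : A v) : A := SigSub (mem_set Av).

Definition pull_perm s : A -> A :=
  fun x => Mplus_sub (pull_Mplus gK gK igK s (Mplus_val x)).

Lemma val_pull_perm s x : val (pull_perm s x) = pull ig g s (val x).
Proof. by []. Qed.

(* Precomposition reverses the order, and so does the product of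
   permutations, which applies its left factor first. *)
Lemma pull_permM s t : pull_perm (s * t)%g = pull_perm s \o pull_perm t.
Proof.
apply/funext => x; apply: val_inj; rewrite /= pull_comp//.
by congr (pull _ _ _ _); apply/funext => a; rewrite permM.
Qed.

Lemma pull_perm1 : pull_perm 1%g = idfun.
Proof.
apply/funext => x; apply: val_inj; rewrite /= pull_id//.
by move=> a; rewrite perm1.
Qed.

Definition unit_point a : A := Mplus_sub (Mplus_delta gK igK (p := (a, 0)) (lexx 0)).

Lemma pull_perm_inj : injective pull_perm.
Proof.
move=> s t st; apply/permP => c; apply/eqP.
(* The unit at [s c] vanishes only there, so its relabelling by t vanishes at c only if t c = s
   c. *)
have /(congr1 (ev ig ^~ c \o val)) := congr1 (fun f => f (unit_point (s c))) st.
rewrite /= !ev_pull// !ev_delta//= eqxx !add0r eq_sym.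
by case: (_ == _) => // /eqP; rewrite eq_sym oner_eq0.
Qed.

Lemma pull_perm_isometric s : s \in Aut [set: G]%SET ->
  isometric_automorphisms dinfty A (star g) evec (pull_perm s).
Proof.
move=> As; have sM : {morph s : a b / (a * b)%g >-> (a * b)%g}.
  by move=> a b; have /morphicP := Aut_morphic As; apply; rewrite inE.
have sK := permK s; have sKV := permKV s.
split.
- by exists (pull_perm s^-1%g) => x;
    have := pull_permM s^-1%g s; have := pull_permM s s^-1%g;
    rewrite mulgV mulVg pull_perm1 => /(congr1 (@^~ x)) /= ? /(congr1 (@^~ x)) /= ?.
- move=> x y z zE; rewrite !val_pull_perm zE.
  exact: (pull_star gK igK g0 gK igK g0 _ _ sK sKV sM).
- move=> x xE; rewrite val_pull_perm xE (evec_delta gK g0).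
  rewrite (pull_delta igK gK igK _ _ sK sKV).
  suff -> : s^-1%g 1%g = 1%g by [].
  by apply: (can_inj sK); apply: (mulgI (s 1%g)); rewrite sKV mulg1 -sM mulg1.
- by move=> x y; rewrite !val_pull_perm (pull_dinfty gK gK igK _ _ sKV).
Qed.

(* The points with all coordinates >= 2 are determined by their distances to
   the units, and any point is brought there by adding 2, that is, by
   multiplying by the translate e + 2, which is itself such a point. *)
Lemma isometric_pull_perm (f : A -> A) :
  isometric_automorphisms dinfty A (star g) evec f ->
  exists2 s, s \in Aut [set: G]%SET & pull_perm s = f.
Proof.
move=> [/bij_inj finj fstar f1 fiso].
have f_unit a : exists b, val (f (unit_point a)) = delta g (b, 0).
  suff : units A (star g) evec (val (f (unit_point a))).
    by rewrite (units_Mplus gK igK g0) => -[b _ <-]; exists b.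
  have fM1 b c : (b * c = 1)%g ->
      star g (val (f (unit_point b))) (val (f (unit_point c))) = evec.
    (* [fstar] speaks of the graph of the product, so the product needs a point of the subtype: for
       b c = 1 it is [unit_point 1], whose value is e. *)
    move=> bc; rewrite -(fstar _ _ (unit_point 1%g)); last first.
      by rewrite /= (star_delta gK igK g0) /prodR_mul/= bc addr0.
    by apply: f1; rewrite /= (evec_delta gK g0).
  split; first exact: Mplus_val.
  exists (val (f (unit_point a^-1%g))); first exact: Mplus_val.
  by rewrite !fM1 ?mulgV ?mulVg.
have [phi phiE] := choice f_unit.
have phiI : injective phi.
  move=> a b ab; have : unit_point a = unit_point b.
    by apply: finj; apply: val_inj; rewrite !phiE ab.
  by move=> /(congr1 val)/(delta_inj igK)[].
have phiM : {morph phi : a b / (a * b)%g >-> (a * b)%g}.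
  move=> a b; have := fstar (unit_point a) (unit_point b) (unit_point (a * b)%g).
  rewrite !phiE /= !(star_delta gK igK g0) /prodR_mul/= addr0.
  by move=> /(_ erefl)/(delta_inj igK)[].
have f_large x : (forall b, 2 <= ev ig (val x) b) ->
    forall a, ev ig (val (f x)) (phi a) = ev ig (val x) a.
  move=> x2 a; have d : dinfty (val (f x)) (delta g (phi a, 0)) = ev ig (val x) a.
    rewrite -phiE fiso; apply: (dinfty_delta gK igK) => //.
    exact: Mplus_Mspace (Mplus_val x).
  by have := ev_dinfty_delta gK igK (Mplus_val (f x)) (a := phi a); rewrite d;
    apply.
pose e2 : A := Mplus_sub (Mplus_delta gK igK (p := (1%g, 2)) (ler0n R 2)).
have phi1 : phi 1%g = 1%g by apply: (mulgI (phi 1%g)); rewrite -phiM !mulg1.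
pose s := perm phiI.
(* [e2] is large, so [f] only permutes its coordinates by [phi]; these depend only on whether the
   index is 1, and [phi] fixes 1. *)
have fe2 : val (f e2) = val e2.
  apply: (ev_inj gK) => c; rewrite -[c](permKV s) permE f_large => [|b].
    by rewrite /= !ev_delta//= -{2}phi1 (inj_eq phiI).
  by rewrite /= ev_delta//= lerDl.
(* The value of [f x] at [phi a] is that of x at a, so [f] is precomposition with the inverse of
   [phi]. *)
exists s^-1%g.
  rewrite groupV inE; apply/andP; split.
    by apply/fintype.subsetP => a; rewrite inE.
  apply/morphicP => a b _ _.
  by rewrite !permE phiM.
apply/funext => x; apply: val_inj; apply: (ev_inj gK) => c.
rewrite val_pull_perm ev_pull//.
pose x2 := Mplus_sub (Mplus_star gK igK g0 (Mplus_val x) (Mplus_val e2)).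
have e2r y b : ev ig (star g (val y) (val e2)) b = ev ig (val y) b + 2.
  rewrite (ev_star_deltar gK igK g0)/= ?invg1 ?mulg1//.
  exact: Mplus_Mspace (Mplus_val y).
have := f_large x2; rewrite (fstar x e2 x2 erefl) fe2 => /(_ _ (s^-1%g c)).
rewrite !e2r -[phi _](permE phiI) permKV => fx.
apply: (addIr 2); rewrite fx// => b; rewrite e2r lerDr.
by have /(MplusP gK)[] := Mplus_val x.
Qed.

Lemma isometric_automorphisms_Aut :
  group_isomorphic (isometric_automorphisms dinfty A (star g) evec)
    (fun f1 f2 => f1 \o f2) idfun
    [set` Aut [set: G]%SET] (fun a b : {perm G} => (a * b)%g) 1%g.
Proof.
have -> : isometric_automorphisms dinfty A (star g) evec =
    pull_perm @` [set` Aut [set: G]%SET].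
  apply/seteqP; split=> [f /isometric_pull_perm[s]|]; first by exists s.
  by move=> _ [s /pull_perm_isometric + <-].
apply: group_isomorphic_image.
- exact: is_group_subgroup.
- by move=> s t _ _; exact: pull_perm_inj.
- by move=> s t _ _; exact: pull_permM.
- exact: pull_perm1.
Qed.

End Automorphisms.

Theorem mainTheorem3 (R : realType) (n : nat) (G : finGroupType)
    (g : 'I_n.+1 -> G) (hg : group_enumeration g) :
  (* (1) *)
  (is_semigroup [set: 'rV[R]_n.+1] (star g) /\
   (abelian [set: G]%SET -> is_abelian [set: 'rV[R]_n.+1] (star g))) /\
  (* (2) *)
  (is_monoid (Mplus R n.+1) (star g) evec /\
   is_monoid (Mspace R n.+1) (star g) evec) /\
  (* (3) *)
  (forall (G' : finGroupType) (g' : 'I_n.+1 -> G'), group_enumeration g' ->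
     (monoid_isomorphic (Mplus R n.+1) (star g) evec
                        (Mplus R n.+1) (star g') evec <->
      [set: G]%SET \isog [set: G']%SET)) /\
  (* (4) *)
  [/\ group_isomorphic (units (Mplus R n.+1) (star g) evec) (star g) evec
        [set: G] (fun a b : G => (a * b)%g) 1%g,
      group_isomorphic (units (Mspace R n.+1) (star g) evec) (star g) evec
        [set: G * R] prodR_mul prodR_one &
      exists H : set 'rV[R]_n.+1,
        is_maximal_subgroup [set: 'rV[R]_n.+1] (star g) evec H /\
        group_isomorphic H (star g) evec [set: G * R] prodR_mul prodR_one] /\
  (* (5) *)
  group_isomorphic
    (isometric_automorphisms dinfty (Mplus R n.+1) (star g) evec)
    (fun f1 f2 => f1 \o f2) idfun
    [set` Aut [set: G]%SET] (fun a b : {perm G} => (a * b)%g) 1%g.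
Proof.
have [[ig gK igK] g0] := hg.
split; [|split; [|split; [|split]]].
- by split; [exact: (star_semigroup gK igK g0) | exact: (star_abelian gK igK g0)].
- by split; [exact: (Mplus_monoid gK igK g0) | exact: (Mspace_monoid gK igK g0)].
- by move=> G' g' hg'; exact: Mplus_isomorphic_isog.
- split.
  + exact: (units_Mplus_isomorphic gK igK g0).
  + exact: (units_Mspace_isomorphic gK igK g0).
  + exists (units (Mspace R n.+1) (star g) evec); split.
      exact: (units_Mspace_maximal gK igK g0).
    exact: (units_Mspace_isomorphic gK igK g0).
- exact: (isometric_automorphisms_Aut gK igK g0).
Qed.
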